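(* Let $d\in\mathbb{N}$, let $H$ be a Hilbert space, let $\rho:\mathrm{Pol}(O_d^+)\to B(H)$ be a unital $^*$-representation, and let $\eta:\mathrm{Pol}(O_d^+)\to H$ be a $\rho$-$\epsilon$-cocycle. Define $B\in M_d(\mathbb{C})$ by $B_{jk}=\sum_{p=1}^d\langle\eta(u_{jp}),\eta(u_{kp})\rangle$. Then $\eta$ admits a generating functional if and only if the matrix $B$ is symmetric, which is the case if and only if $B$ has real entries.
   Context: $\mathrm{Pol}(O_d^+)$ is the universal unital $^*$-algebra generated by selfadjoint elements $u_{jk}=u_{jk}^*$, $1\le j,k\le d$, subject to the relations that $u=(u_{jk})$ is unitary ($uu^*=u^*u=I$). Its character $\epsilon$ is the unital $^*$-homomorphism to $\mathbb{C}$ with $\epsilon(u_{jk})=\delta_{jk}$. Inner products are linear in the second argument. A $\rho$-$\epsilon$-cocycle is a linear map $\eta$ with $\eta(ab)=\rho(a)\eta(b)+\eta(a)\epsilon(b)$ for all $a,b$. The cocycle $\eta$ admits a generating functional if there is a linear functional $\psi:\mathrm{Pol}(O_d^+)\to\mathbb{C}$ such that $(\rho,\eta,\psi)$ is a Schürmann triple, i.e. $\psi(ab)=\psi(a)\epsilon(b)+\epsilon(a)\psi(b)+\langle\eta(a^* ),\eta(b)\rangle$ for all $a,b$. *)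

(* Defs.v *)
From HB Require Import structures.
From mathcomp Require Import all_boot all_order all_algebra.
From mathcomp Require Import generic_quotient.
From mathcomp Require Import all_classical all_reals all_analysis.
From mathcomp.real_closed Require Import complex.

Set Implicit Arguments.
Unset Strict Implicit.
Unset Printing Implicit Defensive.

Import Order.TTheory GRing.Theory Num.Theory.
Import numFieldNormedType.Exports.

Local Open Scope ring_scope.
Local Open Scope quotient_scope.

(* [GRing.Algebra] is unital, associative and requires 1 != 0. *)
HB.mixin Record Algebra_isStar (C : numClosedFieldType) A
    of GRing.Algebra C A := {
  star : A -> A;
  starK : forall x, star (star x) = x;
  starD : forall x y, star (x + y) = star x + star y;
  starZ : forall (c : C) x, star (c *: x) = c^* *: star x;
  starM : forall x y, star (x * y) = star y * star x
}.

#[short(type="starAlgType")]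
HB.structure Definition StarAlgebra (C : numClosedFieldType) :=
  {A of GRing.Algebra C A & Algebra_isStar C A}.

Section StarTheory.
Variables (C : numClosedFieldType) (A : starAlgType C).

Lemma star0 : star (0 : A) = 0.
Proof. by rewrite -[0 in LHS](scale0r (0 : A)) starZ conjC0 scale0r. Qed.

Lemma star1 : star (1 : A) = 1.
Proof. by rewrite -[LHS]mulr1 -[X in _ * X]starK -starM mulr1 starK. Qed.

End StarTheory.

Section RegularStar.
Variable C : numClosedFieldType.

HB.instance Definition _ := Algebra_isStar.Build C C^o
  (star := fun x => x^*) (@conjCK C) (rmorphD _)
  (fun c x => rmorphM _ c x) (fun x y => etrans (rmorphM _ x y) (mulrC _ _)).

End RegularStar.

(* Pol(O_d^+) is built as the *-algebra expressions in the symbols u_jk modulo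
   the smallest congruence that contains the axioms of unital *-algebras, the
   selfadjointness relations [pe_genS] and the unitarity relations [pe_uustar]
   and [pe_ustaru].  The lemmas [pol_lift_u] to [pol_lift_unique] are its
   universal property. *)

Section PolO.
Variables (C : numClosedFieldType) (d : nat).

Inductive expr : Type :=
| Gen of 'I_d & 'I_d
| Zero
| One
| Add of expr & expr
| Scale of C & expr
| Mul of expr & expr
| Star of expr.

Definition delta_expr (j k : 'I_d) : expr := if j == k then One else Zero.

Inductive pol_eq : expr -> expr -> Prop :=
| pe_refl x : pol_eq x x
| pe_sym x y : pol_eq x y -> pol_eq y x
| pe_trans x y z : pol_eq x y -> pol_eq y z -> pol_eq x z
| pe_add x x' y y' : pol_eq x x' -> pol_eq y y' -> pol_eq (Add x y) (Add x' y')
| pe_scale c x x' : pol_eq x x' -> pol_eq (Scale c x) (Scale c x')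
| pe_mul x x' y y' : pol_eq x x' -> pol_eq y y' -> pol_eq (Mul x y) (Mul x' y')
| pe_star x x' : pol_eq x x' -> pol_eq (Star x) (Star x')
| pe_addA x y z : pol_eq (Add x (Add y z)) (Add (Add x y) z)
| pe_addC x y : pol_eq (Add x y) (Add y x)
| pe_add0 x : pol_eq (Add Zero x) x
| pe_addN x : pol_eq (Add (Scale (-1) x) x) Zero
| pe_scaleA a b x : pol_eq (Scale a (Scale b x)) (Scale (a * b) x)
| pe_scale1 x : pol_eq (Scale 1 x) x
| pe_scaleDr a x y : pol_eq (Scale a (Add x y)) (Add (Scale a x) (Scale a y))
| pe_scaleDl a b x : pol_eq (Scale (a + b) x) (Add (Scale a x) (Scale b x))
| pe_mulA x y z : pol_eq (Mul x (Mul y z)) (Mul (Mul x y) z)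
| pe_mul1l x : pol_eq (Mul One x) x
| pe_mul1r x : pol_eq (Mul x One) x
| pe_mulDl x y z : pol_eq (Mul (Add x y) z) (Add (Mul x z) (Mul y z))
| pe_mulDr x y z : pol_eq (Mul x (Add y z)) (Add (Mul x y) (Mul x z))
| pe_scaleAl a x y : pol_eq (Scale a (Mul x y)) (Mul (Scale a x) y)
| pe_scaleAr a x y : pol_eq (Scale a (Mul x y)) (Mul x (Scale a y))
| pe_starK x : pol_eq (Star (Star x)) x
| pe_starD x y : pol_eq (Star (Add x y)) (Add (Star x) (Star y))
| pe_starZ a x : pol_eq (Star (Scale a x)) (Scale a^* (Star x))
| pe_starM x y : pol_eq (Star (Mul x y)) (Mul (Star y) (Star x))
| pe_genS j k : pol_eq (Gen j k) (Star (Gen j k))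
| pe_uustar j k :
    pol_eq (\big[Add/Zero]_(p < d) Mul (Gen j p) (Star (Gen k p)))
           (delta_expr j k)
| pe_ustaru j k :
    pol_eq (\big[Add/Zero]_(p < d) Mul (Star (Gen p j)) (Gen p k))
           (delta_expr j k).

HB.instance Definition _ := gen_eqMixin expr.
HB.instance Definition _ := gen_choiceMixin expr.

Definition pol_eqb (x y : expr) : bool := `[< pol_eq x y >].

Lemma pol_eqb_refl : reflexive pol_eqb.
Proof. by move=> x; apply/asboolP; apply: pe_refl. Qed.

Lemma pol_eqb_sym : symmetric pol_eqb.
Proof. by move=> x y; apply/asboolP/asboolP; apply: pe_sym. Qed.

Lemma pol_eqb_trans : transitive pol_eqb.
Proof.
by move=> y x z /asboolP xy /asboolP yz; apply/asboolP/(pe_trans xy yz).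
Qed.

Canonical pol_equiv : equiv_rel expr :=
  EquivRel pol_eqb pol_eqb_refl pol_eqb_sym pol_eqb_trans.

Definition PolO : Type := {eq_quot pol_equiv}.

HB.instance Definition _ := Choice.on PolO.
HB.instance Definition _ : EqQuotient _ _ PolO := EqQuotient.on PolO.

Definition pol_class (x : expr) : PolO := \pi_PolO x.

Lemma pol_classP x y : pol_class x = pol_class y <-> pol_eq x y.
Proof.
split=> [/eqP|xy]; first by rewrite eqmodE => /asboolP.
by apply/eqP; rewrite eqmodE; apply/asboolP.
Qed.

Lemma repr_pol_class x : pol_eq (repr (pol_class x)) x.
Proof. by apply/pol_classP; rewrite /pol_class reprK. Qed.

Lemma pol_classK (a : PolO) : pol_class (repr a) = a.
Proof. exact: reprK. Qed.

Definition pzero : PolO := pol_class Zero.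
Definition pone : PolO := pol_class One.
Definition padd (a b : PolO) : PolO := pol_class (Add (repr a) (repr b)).
Definition pscale (c : C) (a : PolO) : PolO := pol_class (Scale c (repr a)).
Definition popp (a : PolO) : PolO := pscale (-1) a.
Definition pmul (a b : PolO) : PolO := pol_class (Mul (repr a) (repr b)).
Definition pstar (a : PolO) : PolO := pol_class (Star (repr a)).

Lemma paddE x y : padd (pol_class x) (pol_class y) = pol_class (Add x y).
Proof. by apply/pol_classP/pe_add; apply: repr_pol_class. Qed.

Lemma pscaleE c x : pscale c (pol_class x) = pol_class (Scale c x).
Proof. by apply/pol_classP/pe_scale; apply: repr_pol_class. Qed.

Lemma pmulE x y : pmul (pol_class x) (pol_class y) = pol_class (Mul x y).
Proof. by apply/pol_classP/pe_mul; apply: repr_pol_class. Qed.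

Lemma pstarE x : pstar (pol_class x) = pol_class (Star x).
Proof. by apply/pol_classP/pe_star; apply: repr_pol_class. Qed.

Let pE := (paddE, pscaleE, pmulE, pstarE).

Lemma pol_class_ind (P : PolO -> Prop) : (forall x, P (pol_class x)) -> forall a, P a.
Proof. by move=> Pc a; rewrite -(pol_classK a). Qed.

Lemma paddA : associative padd.
Proof.
by elim/pol_class_ind=> x; elim/pol_class_ind=> y; elim/pol_class_ind=> z;
  rewrite !pE; apply/pol_classP/pe_addA.
Qed.

Lemma paddC : commutative padd.
Proof. by elim/pol_class_ind=> x; elim/pol_class_ind=> y; rewrite !pE; apply/pol_classP/pe_addC. Qed.

Lemma padd0 : left_id pzero padd.
Proof. by elim/pol_class_ind=> x; rewrite !pE; apply/pol_classP/pe_add0. Qed.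

Lemma paddN : left_inverse pzero popp padd.
Proof. by elim/pol_class_ind=> x; rewrite /popp !pE; apply/pol_classP/pe_addN. Qed.

HB.instance Definition _ := GRing.isZmodule.Build PolO paddA paddC padd0 paddN.

Lemma pmulA : associative pmul.
Proof.
by elim/pol_class_ind=> x; elim/pol_class_ind=> y; elim/pol_class_ind=> z;
  rewrite !pE; apply/pol_classP/pe_mulA.
Qed.

Lemma pmul1l : left_id pone pmul.
Proof. by elim/pol_class_ind=> x; rewrite !pE; apply/pol_classP/pe_mul1l. Qed.

Lemma pmul1r : right_id pone pmul.
Proof. by elim/pol_class_ind=> x; rewrite !pE; apply/pol_classP/pe_mul1r. Qed.

Lemma pmulDl : left_distributive pmul padd.
Proof.
by elim/pol_class_ind=> x; elim/pol_class_ind=> y; elim/pol_class_ind=> z;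
  rewrite !pE; apply/pol_classP/pe_mulDl.
Qed.

Lemma pmulDr : right_distributive pmul padd.
Proof.
by elim/pol_class_ind=> x; elim/pol_class_ind=> y; elim/pol_class_ind=> z;
  rewrite !pE; apply/pol_classP/pe_mulDr.
Qed.

Section Eval.
Variables (A : starAlgType C) (v : 'I_d -> 'I_d -> A).

Fixpoint expr_eval (x : expr) : A :=
  match x with
  | Gen j k => v j k
  | Zero => 0
  | One => 1
  | Add x y => expr_eval x + expr_eval y
  | Scale c x => c *: expr_eval x
  | Mul x y => expr_eval x * expr_eval y
  | Star x => star (expr_eval x)
  end.

Record orthogonal_family : Prop := OrthogonalFamily {
  of_selfadjoint : forall j k, star (v j k) = v j k;
  of_uustar : forall j k, \sum_(p < d) v j p * star (v k p) = (j == k)%:R;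
  of_ustaru : forall j k, \sum_(p < d) star (v p j) * v p k = (j == k)%:R
}.

Lemma expr_eval_big (F : 'I_d -> expr) :
  expr_eval (\big[Add/Zero]_(p < d) F p) = \sum_(p < d) expr_eval (F p).
Proof. exact: (big_morph expr_eval (id1 := 0) (op1 := +%R)). Qed.

Lemma expr_eval_delta j k : expr_eval (delta_expr j k) = (j == k)%:R.
Proof. by rewrite /delta_expr; case: eqP. Qed.

Lemma expr_eval_eq : orthogonal_family ->
  forall x y, pol_eq x y -> expr_eval x = expr_eval y.
Proof.
move=> [vS vuu vsu] x y.
elim=> {x y} //=.
- by move=> x y z _ -> _ ->.
- by move=> x x' y y' _ -> _ ->.
- by move=> c x x' _ ->.
- by move=> x x' y y' _ -> _ ->.
- by move=> x x' _ ->.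
- by move=> x y z; rewrite addrA.
- by move=> x y; rewrite addrC.
- by move=> x; rewrite add0r.
- by move=> x; rewrite scaleN1r addNr.
- by move=> a b x; rewrite scalerA.
- by move=> x; rewrite scale1r.
- by move=> a x y; rewrite scalerDr.
- by move=> a b x; rewrite scalerDl.
- by move=> x y z; rewrite mulrA.
- by move=> x; rewrite mul1r.
- by move=> x; rewrite mulr1.
- by move=> x y z; rewrite mulrDl.
- by move=> x y z; rewrite mulrDr.
- by move=> a x y; rewrite scalerAl.
- by move=> a x y; rewrite scalerAr.
- by move=> x; rewrite starK.
- by move=> x y; rewrite starD.
- by move=> a x; rewrite starZ.
- by move=> x y; rewrite starM.
- by move=> j k; rewrite expr_eval_big expr_eval_delta; apply: vuu.
- by move=> j k; rewrite expr_eval_big expr_eval_delta; apply: vsu.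
Qed.

Definition pol_lift (a : PolO) : A := expr_eval (repr a).

Lemma pol_lift_cls x : orthogonal_family -> pol_lift (pol_class x) = expr_eval x.
Proof. by move=> hv; apply: expr_eval_eq => //; apply: repr_pol_class. Qed.

End Eval.

Definition delta_fam (j k : 'I_d) : C^o := (j == k)%:R.

Lemma delta_fam_orthogonal : orthogonal_family delta_fam.
Proof.
have sE j k : star (delta_fam j k) = delta_fam j k by exact: conjC_nat.
split=> [//|j k|j k]; under eq_bigr do rewrite sE /delta_fam.
- rewrite (bigD1 j) //= eqxx mul1r big1 ?addr0 1?eq_sym // => p /negPf pj.
  by rewrite eq_sym pj mul0r.
- rewrite (bigD1 j) //= eqxx mul1r big1 ?addr0 // => p /negPf pj.
  by rewrite pj mul0r.
Qed.

Lemma pone_neq0 : pone != pzero.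
Proof.
apply/eqP => /pol_classP /(expr_eval_eq delta_fam_orthogonal) /eqP.
by rewrite /= oner_eq0.
Qed.

HB.instance Definition _ := GRing.Zmodule_isNzRing.Build PolO
  pmulA pmul1l pmul1r pmulDl pmulDr pone_neq0.

Lemma pscaleA a b (x : PolO) : pscale a (pscale b x) = pscale (a * b) x.
Proof. by elim/pol_class_ind: x => x; rewrite !pE; apply/pol_classP/pe_scaleA. Qed.

Lemma pscale1 : left_id 1 pscale.
Proof. by elim/pol_class_ind=> x; rewrite !pE; apply/pol_classP/pe_scale1. Qed.

Lemma pscaleDr : right_distributive pscale +%R.
Proof.
by move=> a; elim/pol_class_ind=> x; elim/pol_class_ind=> y;
  rewrite /GRing.add /= !pE; apply/pol_classP/pe_scaleDr.
Qed.

Lemma pscaleDl (x : PolO) : {morph pscale^~ x : a b / a + b}.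
Proof.
by elim/pol_class_ind: x => x a b; rewrite /GRing.add /= !pE; apply/pol_classP/pe_scaleDl.
Qed.

HB.instance Definition _ := GRing.Zmodule_isLmodule.Build C PolO
  pscaleA pscale1 pscaleDr pscaleDl.

Lemma pscaleAl (a : C) (x y : PolO) : a *: (x * y) = a *: x * y.
Proof.
by elim/pol_class_ind: x => x; elim/pol_class_ind: y => y;
  rewrite /GRing.mul /GRing.scale /= !pE; apply/pol_classP/pe_scaleAl.
Qed.

HB.instance Definition _ := GRing.Lmodule_isLalgebra.Build C PolO pscaleAl.

Lemma pscaleAr (a : C) (x y : PolO) : a *: (x * y) = x * (a *: y).
Proof.
by elim/pol_class_ind: x => x; elim/pol_class_ind: y => y;
  rewrite /GRing.mul /GRing.scale /= !pE; apply/pol_classP/pe_scaleAr.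
Qed.

HB.instance Definition _ := GRing.Lalgebra_isAlgebra.Build C PolO pscaleAr.

Lemma pstarK (x : PolO) : pstar (pstar x) = x.
Proof. by elim/pol_class_ind: x => x; rewrite !pE; apply/pol_classP/pe_starK. Qed.

Lemma pstarD (x y : PolO) : pstar (x + y) = pstar x + pstar y.
Proof.
by elim/pol_class_ind: x => x; elim/pol_class_ind: y => y;
  rewrite /GRing.add /= !pE; apply/pol_classP/pe_starD.
Qed.

Lemma pstarZ (c : C) (x : PolO) : pstar (c *: x) = c^* *: pstar x.
Proof.
by elim/pol_class_ind: x => x; rewrite /GRing.scale /= !pE; apply/pol_classP/pe_starZ.
Qed.

Lemma pstarM (x y : PolO) : pstar (x * y) = pstar y * pstar x.
Proof.
by elim/pol_class_ind: x => x; elim/pol_class_ind: y => y;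
  rewrite /GRing.mul /= !pE; apply/pol_classP/pe_starM.
Qed.

HB.instance Definition _ :=
  Algebra_isStar.Build C PolO pstarK pstarD pstarZ pstarM.

Definition pol_gen (j k : 'I_d) : PolO := pol_class (Gen j k).

Lemma pol_classD x y : pol_class (Add x y) = pol_class x + pol_class y. Proof. by rewrite -paddE. Qed.
Lemma pol_classM x y : pol_class (Mul x y) = pol_class x * pol_class y. Proof. by rewrite -pmulE. Qed.
Lemma pol_classZ c x : pol_class (Scale c x) = c *: pol_class x. Proof. by rewrite -pscaleE. Qed.
Lemma pol_classS x : pol_class (Star x) = star (pol_class x). Proof. by rewrite -pstarE. Qed.
Lemma pol_class0 : pol_class Zero = 0. Proof. by []. Qed.
Lemma pol_class1 : pol_class One = 1. Proof. by []. Qed.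

Lemma pol_class_big (F : 'I_d -> expr) :
  pol_class (\big[Add/Zero]_(p < d) F p) = \sum_(p < d) pol_class (F p).
Proof. exact: (big_morph pol_class pol_classD pol_class0). Qed.

Lemma pol_class_delta j k : pol_class (delta_expr j k) = (j == k)%:R.
Proof. by rewrite /delta_expr; case: eqP. Qed.

Lemma pol_gen_orthogonal : orthogonal_family pol_gen.
Proof.
split=> j k.
- by rewrite -pol_classS; apply/esym/pol_classP/pe_genS.
- under eq_bigr do rewrite -pol_classS -pol_classM.
  by rewrite -pol_class_big -pol_class_delta; apply/pol_classP/pe_uustar.
- under eq_bigr do rewrite -pol_classS -pol_classM.
  by rewrite -pol_class_big -pol_class_delta; apply/pol_classP/pe_ustaru.
Qed.

Section Universal.
Context (A : starAlgType C) (v : 'I_d -> 'I_d -> A) (hv : orthogonal_family v).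

Lemma pol_lift_u j k : pol_lift v (pol_gen j k) = v j k.
Proof. by rewrite pol_lift_cls. Qed.

Lemma pol_lift_linear : linear (pol_lift v).
Proof.
move=> c; elim/pol_class_ind=> x; elim/pol_class_ind=> y.
by rewrite -pol_classZ -pol_classD !pol_lift_cls.
Qed.

Lemma pol_lift_monoid_morphism : monoid_morphism (pol_lift v).
Proof.
split; first by rewrite -pol_class1 pol_lift_cls.
by elim/pol_class_ind=> x; elim/pol_class_ind=> y; rewrite -pol_classM !pol_lift_cls.
Qed.

Lemma pol_lift_star (a : PolO) : pol_lift v (star a) = star (pol_lift v a).
Proof. by elim/pol_class_ind: a => x; rewrite -pol_classS !pol_lift_cls. Qed.

Lemma pol_lift_unique (f : {lrmorphism PolO -> A}) :
  (forall a, f (star a) = star (f a)) ->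
  (forall j k, f (pol_gen j k) = v j k) -> f =1 pol_lift v.
Proof.
move=> fS fu; elim/pol_class_ind=> x; rewrite pol_lift_cls //.
elim: x => [j k|||x IHx y IHy|c x IHx|x IHx y IHy|x IHx] /=.
- exact: fu.
- by rewrite pol_class0 rmorph0.
- by rewrite pol_class1 rmorph1.
- by rewrite pol_classD rmorphD /= IHx IHy.
- by rewrite pol_classZ linearZ /= IHx.
- by rewrite pol_classM rmorphM /= IHx IHy.
- by rewrite pol_classS fS IHx.
Qed.

End Universal.

Definition counit : PolO -> C := pol_lift delta_fam.

Lemma counit_u j k : counit (pol_gen j k) = (j == k)%:R.
Proof. exact: pol_lift_u delta_fam_orthogonal j k. Qed.

Lemma counit_star (a : PolO) : counit (star a) = (counit a)^*.
Proof. exact: pol_lift_star delta_fam_orthogonal a. Qed.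

Lemma counit_scalar : scalar counit.
Proof. exact: (pol_lift_linear delta_fam_orthogonal). Qed.

HB.instance Definition _ := GRing.isLinear.Build C PolO C *%R counit
  counit_scalar.

HB.instance Definition _ := GRing.isMonoidMorphism.Build PolO C counit
  (pol_lift_monoid_morphism delta_fam_orthogonal).

End PolO.

Arguments pol_gen {C d}.
Arguments counit {C d}.

HB.mixin Record CompleteNormedModule_isHilbert (R : realType) H
    of CompleteNormedModule R[i] H := {
  hdot : {dot H for @Num.conj R[i]};
  hdot_norm : forall x : H, hdot x x = `|x| ^+ 2
}.

#[short(type="hilbertType")]
HB.structure Definition Hilbert (R : realType) :=
  {H of CompleteNormedModule R[i] H & CompleteNormedModule_isHilbert R H}.

(* The forms [{dot _ for _}] are linear in the first argument; [inner] is
   linear in the second one. *)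
Definition inner (R : realType) (H : hilbertType R) (x y : H) : R[i] :=
  hdot y x.

Definition bounded_operator (R : realType) (H : hilbertType R)
    (T : {linear H -> H}) : Prop :=
  exists M : R, forall x, `|T x| <= M%:C%C * `|x|.

(* S = T^* *)
Definition is_adjoint (R : realType) (H : hilbertType R)
    (T S : {linear H -> H}) : Prop :=
  forall x y, inner (S x) y = inner x (T y).

Section Schurmann.
Variables (R : realType) (d : nat) (H : hilbertType R).
Local Notation Pol := (PolO R[i] d).
Implicit Types (rho : Pol -> {linear H -> H}) (eta : {linear Pol -> H}).

Record star_representation rho : Prop := StarRepresentation {
  rep_bounded : forall a, bounded_operator (rho a);
  rep_linear : forall (c : R[i]) a b x,
    rho (c *: a + b) x = c *: rho a x + rho b x;
  rep_one : forall x, rho 1 x = x;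
  rep_mul : forall a b x, rho (a * b) x = rho a (rho b x);
  rep_star : forall a, is_adjoint (rho a) (rho (star a))
}.

Definition cocycle rho eta : Prop :=
  forall a b, eta (a * b) = rho a (eta b) + counit b *: eta a.

Record schurmann_triple rho eta (psi : {scalar Pol}) : Prop :=
  SchurmannTriple {
    st_rep : star_representation rho;
    st_cocycle : cocycle rho eta;
    st_psi : forall a b, psi (a * b) =
      psi a * counit b + counit a * psi b + inner (eta (star a)) (eta b)
  }.

Definition admits_generating_functional rho eta : Prop :=
  exists psi : {scalar Pol}, schurmann_triple rho eta psi.

Definition cocycle_matrix eta : 'M[R[i]]_d :=
  \matrix_(j, k) \sum_(p < d) inner (eta (pol_gen j p)) (eta (pol_gen k p)).

End Schurmann.

(* Main.v *)
Require Import Defs.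
From HB Require Import structures.
From mathcomp Require Import all_boot all_order all_algebra.
From mathcomp Require Import all_classical all_reals all_analysis.
From mathcomp.real_closed Require Import complex.
From mathcomp Require Import ring.

Set Implicit Arguments.
Unset Strict Implicit.
Unset Printing Implicit Defensive.

Import Order.TTheory GRing.Theory Num.Theory.
Local Open Scope ring_scope.

(** If psi is a generating functional, applying it to
    sum_p u_jp u_kp = delta_jk gives B_jk = - psi(u_jk) - psi(u_kj), which is
    symmetric in j and k.  Conversely, the values psi(u_jk) = - B_jk / 2 and the
    coboundary identity determine psi on *-algebra expressions, and it remains to
    see that psi respects the defining relations: selfadjointness of u_jk needs B
    real, u u^* = 1 needs B symmetric, and u^* u = 1 needs in addition
    sum_p <eta(u_pj), eta(u_pk)> = B_jk, which holds for every cocycle because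
    eta(u_pj) = - sum_q rho(u_pq) eta(u_jq) and rho(u) is unitary. *)

(** * Sesquilinearity of [inner] *)

Section Inner.
Variables (R : realType) (H : hilbertType R).
Implicit Types x y z : H.

Lemma innerDr x y z : inner x (y + z) = inner x y + inner x z.
Proof. exact: linearDl. Qed.

Lemma innerDl x y z : inner (x + y) z = inner x z + inner y z.
Proof. exact: linearDr. Qed.

Lemma innerZr c x y : inner x (c *: y) = c * inner x y.
Proof. exact: linearZl_LR. Qed.

Lemma innerZl c x y : inner (c *: x) y = c^* * inner x y.
Proof. exact: linearZr_LR. Qed.

Lemma innerC x y : inner x y = (inner y x)^*.
Proof. by rewrite /inner hermC expr0 mul1r. Qed.

Lemma inner0r x : inner x 0 = 0.
Proof. exact: linear0l. Qed.

Lemma inner0l x : inner 0 x = 0.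
Proof. exact: linear0r. Qed.

Lemma innerNN x y : inner (- x) (- y) = inner x y.
Proof. by rewrite /inner linearNl linearNr opprK. Qed.

Lemma inner_sumr (I : finType) x (F : I -> H) :
  inner x (\sum_i F i) = \sum_i inner x (F i).
Proof. exact: linear_sumlz. Qed.

Lemma inner_suml (I : finType) (F : I -> H) x :
  inner (\sum_i F i) x = \sum_i inner (F i) x.
Proof. exact: linear_sumr. Qed.

End Inner.

(** * Cocycles on [Pol] and their generating functionals *)

Section Cocycle.
Variables (R : realType) (d : nat) (H : hilbertType R).
Local Notation Pol := (PolO R[i] d).
Local Notation u := (@pol_gen R[i] d).
Variables (rho : Pol -> {linear H -> H}) (eta : {linear Pol -> H}).
Hypotheses (rhoP : star_representation rho) (etaP : cocycle rho eta).
Local Notation B := (cocycle_matrix eta).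

Lemma star_gen j k : star (u j k) = u j k.
Proof. exact: of_selfadjoint (pol_gen_orthogonal _ _) j k. Qed.

Lemma gen_row_orthogonal j k : \sum_(p < d) u j p * u k p = (j == k)%:R.
Proof.
rewrite -(of_uustar (pol_gen_orthogonal _ _)).
by under [RHS]eq_bigr do rewrite star_gen.
Qed.

Lemma gen_col_orthogonal j k : \sum_(p < d) u p j * u p k = (j == k)%:R.
Proof.
rewrite -(of_ustaru (pol_gen_orthogonal _ _)).
by under [RHS]eq_bigr do rewrite star_gen.
Qed.

Lemma cocycle_matrixC j k : B k j = (B j k)^*.
Proof.
by rewrite !mxE rmorph_sum; apply: eq_bigr => p _; rewrite innerC.
Qed.

(** As a Gram-type matrix [B] is Hermitian, so transposing it amounts to conjugating its entries. *)
Lemma cocycle_matrix_sym_real :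
  B^T = B <-> forall j k, B j k \is Num.real.
Proof.
split=> [Bsym j k|Breal].
  by apply/CrealP; rewrite -cocycle_matrixC -[in LHS]Bsym mxE.
by apply/matrixP => j k; rewrite mxE cocycle_matrixC; apply/CrealP.
Qed.

Lemma rep_sum (I : finType) (F : I -> Pol) x :
  rho (\sum_i F i) x = \sum_i rho (F i) x.
Proof.
apply: (big_morph (fun a => rho a x)) => [a b|].
  by rewrite -[a]scale1r (rep_linear rhoP) !scale1r.
(* [rep_linear] speaks only of [c *: a + b], so 0 is written as [-1 *: 1 + 1]. *)
by rewrite -[0 : Pol](addNr 1) -scaleN1r (rep_linear rhoP) scaleN1r addNr.
Qed.

Lemma rep_delta j k x : rho (j == k :> 'I_d)%:R x = (j == k)%:R *: x.
Proof.
case: eqP => _; first by rewrite (rep_one rhoP) scale1r.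
rewrite -[0%:R : Pol](addNr 1) -scaleN1r (rep_linear rhoP) scaleN1r addNr.
by rewrite scale0r.
Qed.

Lemma rep_adjoint a x y : inner (rho a x) y = inner x (rho (star a) y).
Proof. by rewrite -{1}[a]starK; apply: rep_star. Qed.

(** The cocycle identity at 1 = 1 * 1 reads [eta 1 = eta 1 + eta 1]. *)
Lemma cocycle1 : eta 1 = 0.
Proof.
apply: (addrI (eta 1)); rewrite addr0 -{3}[1](mulr1 1) etaP.
by rewrite (rep_one rhoP) rmorph1 scale1r.
Qed.

Lemma cocycle_delta j k : eta (j == k :> 'I_d)%:R = 0.
Proof. by case: eqP => _; rewrite ?cocycle1 ?linear0. Qed.

(** Collapses the counit terms that remain when a cocycle or coboundary identity is summed over an
    orthogonality relation. A general [V] covers vectors as well as scalars, seen as [R[i]^o]. *)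
Lemma sum_counit_gen (V : lmodType R[i]) k (F : 'I_d -> V) :
  \sum_(p < d) counit (u k p) *: F p = F k.
Proof.
rewrite (bigD1 k) //= counit_u eqxx scale1r big1 ?addr0 // => p /negPf pk.
by rewrite counit_u eq_sym pk scale0r.
Qed.

Lemma sum_counit_genV (V : lmodType R[i]) k (F : 'I_d -> V) :
  \sum_(p < d) counit (u p k) *: F p = F k.
Proof.
rewrite -[RHS]sum_counit_gen; apply: eq_bigr => p _.
by rewrite !counit_u eq_sym.
Qed.

(** Apply [eta] to the row relation sum_p u_jp u_kp = delta_jk, whose right side is killed by
    [eta]. *)
Lemma cocycle_gen j k :
  eta (u j k) = - \sum_(p < d) rho (u j p) (eta (u k p)).
Proof.
apply/eqP; rewrite -addr_eq0 addrC -{1}(sum_counit_gen k (fun p => eta (u j p))).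
rewrite -big_split /=; under eq_bigr do rewrite -etaP.
by rewrite -linear_sum gen_row_orthogonal cocycle_delta.
Qed.

Lemma cocycle_matrix_col j k :
  \sum_(p < d) inner (eta (u p j)) (eta (u p k)) = B j k.
Proof.
have E p : inner (eta (u p j)) (eta (u p k)) =
    \sum_q \sum_r inner (eta (u j q)) (rho (u p q * u p r) (eta (u k r))).
  rewrite !cocycle_gen innerNN inner_suml; apply: eq_bigr => q _.
  rewrite inner_sumr; apply: eq_bigr => r _.
  by rewrite rep_adjoint star_gen (rep_mul rhoP).
under eq_bigr do rewrite E.
(* With the sum over p innermost, the column relation turns sum_p u_pq u_pr into delta_qr, so only r
   = q survives. *)
rewrite exchange_big mxE; apply: eq_bigr => q _.
rewrite exchange_big /= (bigD1 q) //= [X in _ + X]big1 ?addr0 => [|r /negPf rq];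
  rewrite -inner_sumr -rep_sum gen_col_orthogonal rep_delta.
- by rewrite eqxx scale1r.
- by rewrite eq_sym rq scale0r inner0r.
Qed.

Lemma generating_functional_sym :
  admits_generating_functional rho eta -> B^T = B.
Proof.
case=> psi [_ _ psiM].
have psi1 : psi 1 = 0.
  apply: (addrI (psi 1)); rewrite addr0 -{3}[1](mulr1 1) psiM.
  by rewrite rmorph1 mulr1 mul1r cocycle1 inner0r addr0.
have BE j k : B j k = - (psi (u j k) + psi (u k j)).
  apply/eqP; rewrite -addr_eq0 addrC mxE.
  rewrite -{1}(sum_counit_gen (V := R[i]^o) k (fun p => psi (u j p))).
  rewrite -(sum_counit_gen (V := R[i]^o) j (fun p => psi (u k p))).
  rewrite -!big_split /=.
  have -> : \sum_(p < d) (counit (u k p) * psi (u j p) +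
      counit (u j p) * psi (u k p) + inner (eta (u j p)) (eta (u k p))) =
      psi (\sum_(p < d) u j p * u k p).
    rewrite linear_sum; apply: eq_bigr => p _.
    by rewrite /= psiM star_gen [psi _ * _]mulrC.
  by rewrite gen_row_orthogonal; case: (j == k); rewrite ?psi1 ?linear0.
by apply/matrixP => j k; rewrite mxE !BE addrC.
Qed.

(** Defined on raw expressions, where no relation has to be respected yet. Since [counit] and [eta]
    already live on the quotient, the [Mul] clause can be the coboundary identity itself. For
    symmetric [B], the value on [Gen] is the solution of B_jk = - psi(u_jk) - psi(u_kj) that is
    symmetric in j and k. *)
Fixpoint expr_functional (x : expr R[i] d) : R[i] :=
  match x with
  | Gen j k => - (B j k / 2)
  | Zero => 0
  | One => 0
  | Add x y => expr_functional x + expr_functional y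
  | Scale c x => c * expr_functional x
  | Mul x y =>
      expr_functional x * counit (pol_class y) +
      counit (pol_class x) * expr_functional y +
      inner (eta (star (pol_class x))) (eta (pol_class y))
  | Star x => (expr_functional x)^*
  end.

Lemma expr_functional_big (F : 'I_d -> expr R[i] d) :
  expr_functional (\big[@Add _ _/@Zero _ _]_(p < d) F p) =
  \sum_(p < d) expr_functional (F p).
Proof. exact: (big_morph expr_functional (id1 := 0) (op1 := +%R)). Qed.

Lemma expr_functional_delta j k :
  expr_functional (delta_expr R[i] j k) = 0.
Proof. by rewrite /delta_expr; case: eqP. Qed.

Lemma expr_functional_eq : B^T = B ->
  forall x y, pol_eq x y -> expr_functional x = expr_functional y.
Proof.
move=> Bsym x y.
have Breal j k : (B j k)^* = B j k.
  by apply/CrealP; apply: (cocycle_matrix_sym_real.1 Bsym).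
have BT j k : B k j = B j k by rewrite -[in RHS]Bsym [RHS]mxE.
have genS j k : (- (B j k / 2))^* = - (B j k / 2).
  by rewrite rmorphN rmorphM /= Breal fmorphV rmorph_nat.
have halves (c : R[i]) : - (c / 2) - c / 2 + c = 0.
  by rewrite -opprD -splitr addNr.
elim=> {x y} //=.
- by move=> x y z _ -> _ ->.
- by move=> x x' y y' _ -> _ ->.
- by move=> c x x' _ ->.
(* The [Mul] clause also depends on the classes of the factors, hence [pol_classP] besides the
   induction hypotheses. *)
- by move=> x x' y y' /pol_classP -> -> /pol_classP -> ->.
- by move=> x x' _ ->.
- by move=> x y z; rewrite addrA.
- by move=> x y; rewrite addrC.
- by move=> x; rewrite add0r.
- by move=> x; rewrite mulN1r addNr.
- by move=> a b x; rewrite mulrA.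
- by move=> x; rewrite mul1r.
- by move=> a x y; rewrite mulrDr.
- by move=> a b x; rewrite mulrDl.
- move=> x y z; rewrite !pol_classM !rmorphM /= starM !etaP.
  rewrite innerDr innerDl innerZr innerZl rep_adjoint starK counit_star conjCK.
  ring.
- move=> x; rewrite pol_class1 star1 cocycle1 inner0l rmorph1.
  by rewrite mul0r mul1r add0r addr0.
- move=> x; rewrite pol_class1 cocycle1 inner0r rmorph1.
  by rewrite mulr0 mulr1 !addr0.
- move=> x y z; rewrite pol_classD starD !linearD /= innerDl.
  ring.
- move=> x y z; rewrite pol_classD !linearD /= innerDr.
  ring.
- move=> a x y; rewrite pol_classZ starZ !linearZ /= innerZl conjCK.
  ring.
- move=> a x y; rewrite pol_classZ !linearZ /= innerZr.
  ring.
- by move=> x; rewrite conjCK.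
- by move=> x y; rewrite rmorphD.
- by move=> a x; rewrite rmorphM.
- move=> x y; rewrite !pol_classS starK !counit_star !rmorphD !rmorphM /=.
  by rewrite -innerC [_^* * _]mulrC [X in _ + X + _]mulrC; congr (_ + _); rewrite addrC.
(* Row relation: the counit terms give - B_jk / 2 - B_kj / 2, and the inner products add up to
   B_jk. *)
- move=> j k; rewrite expr_functional_big expr_functional_delta.
  transitivity (\sum_(p < d) (counit (u k p) *: (- (B j p / 2) : R[i]^o) +
      counit (u j p) *: (- (B k p / 2) : R[i]^o) +
      inner (eta (u j p)) (eta (u k p)))).
    apply: eq_bigr => p _; rewrite /= genS pol_classS -!/(pol_gen _ _) !star_gen.
    by rewrite [X in X + _ + _]mulrC.
  rewrite !big_split !sum_counit_gen /= (BT j k) -[RHS](halves (B j k)).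
  by rewrite [X in _ = _ + X]mxE.
(* Column relation: the same cancellation, where the inner products now give B_jk through
   [cocycle_matrix_col]. *)
- move=> j k; rewrite expr_functional_big expr_functional_delta.
  transitivity (\sum_(p < d) (counit (u p k) *: (- (B p j / 2) : R[i]^o) +
      counit (u p j) *: (- (B p k / 2) : R[i]^o) +
      inner (eta (u p j)) (eta (u p k)))).
    apply: eq_bigr => p _; rewrite /= genS pol_classS -!/(pol_gen _ _) !star_gen.
    by rewrite [X in X + _ + _]mulrC.
  rewrite !big_split !sum_counit_genV /= cocycle_matrix_col (BT k j).
  exact: halves.
Qed.

Lemma sym_generating_functional :
  B^T = B -> admits_generating_functional rho eta.
Proof.
(* By [expr_functional_eq] the choice of representative is immaterial, so linearity and the
   coboundary identity can be read off the clauses of [expr_functional]. *)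
move=> Bsym; pose psi (a : Pol) := expr_functional (repr a).
have psiE x : psi (pol_class x) = expr_functional x.
  by apply: expr_functional_eq => //; apply: repr_pol_class.
have psi_scalar : scalar psi.
  move=> c; elim/pol_class_ind=> x; elim/pol_class_ind=> y.
  by rewrite -pol_classZ -pol_classD !psiE.
pose psiM := GRing.isLinear.Build R[i] Pol R[i] *%R psi psi_scalar.
pose psiL : {scalar Pol} := HB.pack psi psiM.
exists psiL; split=> //.
elim/pol_class_ind=> x; elim/pol_class_ind=> y.
by rewrite /= -pol_classM !psiE.
Qed.

End Cocycle.

Theorem theorem3p8 (R : realType) (d : nat) (H : hilbertType R)
    (rho : PolO R[i] d -> {linear H -> H}) (eta : {linear PolO R[i] d -> H}) :
  star_representation rho -> cocycle rho eta ->
  let B := cocycle_matrix eta in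
  (admits_generating_functional rho eta <-> B^T = B) /\
  (B^T = B <-> forall j k, B j k \is Num.real).
Proof.
move=> rhoP etaP B; split; last exact: cocycle_matrix_sym_real.
split; first exact: generating_functional_sym.
exact: sym_generating_functional.
Qed.
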